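(* Let $R$ be a finite commutative chain ring with residue field of size $q=p^r$ ($p$ prime) and nilpotency index $s$. For a positive integer $n$, let $\mathcal{C}\subseteq R^n$ be a linear code and let $\mathcal{C}^\perp$ be its dual. For a given Lee decomposition $\rho\in\mathbb{D}^{\mathsf L}_n$, the number of codewords of $\mathcal{C}^\perp$ of Lee decomposition $\rho$ is $$\mathcal{D}^{\mathsf L}_\rho(\mathcal{C}^\perp)=\frac{1}{|\mathcal{C}|}\sum_{\pi\in\mathbb{D}^{\mathsf L}_n}K^{\mathsf L}_\pi(\rho)\,\mathcal{D}^{\mathsf L}_\pi(\mathcal{C}).$$ Here $K^{\mathsf L}_\pi(\rho)$ is the value of the Krawtchouk coefficient of $\rho$ with respect to $\pi$ and, for a given $p^s$-th root of unity $\xi$, it is given by $$K^{\mathsf L}_\pi(\rho)=\sum_{t\in \mathrm{Comp}^{\mathsf L}_\pi(\rho)}\left(\prod_{i=0}^M\binom{\pi_i}{t_{i0},\dots,t_{iM}}\,\kappa^{\mathsf L}\right),$$ where (the factor $\kappa^{\mathsf L}$ depending on $i$ and $t$) $$\kappa^{\mathsf L}=\begin{cases}\displaystyle\prod_{j=1}^{M-1}\bigl(\xi^{-\mathrm{Tr}(\alpha_i\alpha_j)}+\xi^{\mathrm{Tr}(\alpha_i\alpha_j)}\bigr)^{t_{ij}}\;\xi^{\mathrm{Tr}(\alpha_i\alpha_M)\,t_{iM}} & \text{if } p=2,\\[2mm] \displaystyle\prod_{j=1}^{M}\bigl(\xi^{-\mathrm{Tr}(\alpha_i\alpha_j)}+\xi^{\mathrm{Tr}(\alpha_i\alpha_j)}\bigr)^{t_{ij}}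 & \text{otherwise,}\end{cases}$$ and, for any $k\in\{0,\dots,M\}$, $\alpha_k$ denotes any element of the block $I^{\mathsf L}_k$ of the Lee partition.
   Context: A linear code $\mathcal{C}\subseteq R^n$ is an $R$-submodule; its dual is $\mathcal{C}^\perp=\{x\in R^n:\sum_i x_ic_i=0\ \text{for all } c\in\mathcal{C}\}$. The ring $R$ has $q^s$ elements, and $M=\lfloor q^s/2\rfloor$. Lee partition of $R$. If the characteristic of $R$ is different from $2$, the elements of $R$ are labelled $\alpha_0=0,\alpha_1,\dots,\alpha_{q^s-1}$ so that $\alpha_{q^s-i}=-\alpha_i$, and the Lee partition has blocks $I^{\mathsf L}_i=\{\alpha_i,-\alpha_i\}$ for $0\le i\le M$. If the characteristic of $R$ is $2$, every element is its own additive inverse, no such labelling is required, and the Lee partition consists of the singletons $I_i^{\mathsf L}=\{\alpha_i\}$, one for each element of $R$. In either case write the blocks as $I^{\mathsf L}_0,\dots,I^{\mathsf L}_m$. For $x\in R^n$ its Lee decomposition is $\pi(x)=(\pi_0(x),\dots,\pi_m(x))$ with $\pi_i(x)=|\{k:x_k\in I^{\mathsf L}_i\}|$. $\mathbb{D}^{\mathsf L}_n$ is the set of all Lee decompositions of elements of $R^n$, and $\mathcal{D}^{\mathsf L}_\pi(\mathcal{C})=|\{c\in\mathcal{C}:\pi(c)=\pi\}|$. For $\pi,\rho\in\mathbb{D}^{\mathsf L}_n$, $\mathrm{Comp}^{\mathsf L}_\pi(\rho)$ is the set of all arrays $t=(t_{ij})_{0\le i,j\le m}$ of nonnegative integers with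 $\sum_j t_{ij}=\pi_i$ for all $i$ and $\sum_i t_{ij}=\rho_j$ for all $j$. The multinomial coefficient is $\binom{a}{k_0,\dots,k_M}=\frac{a!}{k_0!\cdots k_M!}$. The map $y\mapsto\xi^{\mathrm{Tr}(y)}$ is the additive character of $R$, built from the trace and the root of unity $\xi$, for which all characters of $(R,+)$ are of the form $\chi_a(x)=\xi^{\mathrm{Tr}(ax)}$, $a\in R$. The Krawtchouk coefficient of $\rho$ with respect to $\pi$ is the sum $\sum_x\prod_k\chi_{a_k}(x_k)$ over all $x\in R^n$ of Lee decomposition $\rho$, where $a\in R^n$ is any element of Lee decomposition $\pi$.
   Formalization: In characteristic 2 with |R|>2 the displayed κ^L is false (e.g. R=F_4, n=1); there it is replaced by ∏_{j=0}^m ξ^{Tr(α_iα_j)t_ij}, with i,j running to m instead of M. Also α_0=0 in characteristic 2, and the labelling is assumed to exist otherwise. *)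

(* Defs.v *)
(* The complex numbers are represented by algC. *)
From HB Require Import structures.
From mathcomp Require Import all_boot all_order all_algebra.
From mathcomp Require Import all_fingroup all_solvable all_field all_character.

Set Implicit Arguments.
Unset Strict Implicit.
Unset Printing Implicit Defensive.

Import GRing.Theory Num.Theory.
Local Open Scope ring_scope.

Section ChainRings.
Variable R : finComNzRingType.
Implicit Types I J A : {set R}.

(* Unlike idealr_closed, this does not require I to be proper. *)
Definition ideal I : bool :=
  (0 \in I) &&
  [forall a : R, forall u in I, forall v in I, a * u + v \in I].

Definition chain_ring : Prop :=
  forall I J, ideal I -> ideal J -> (I \subset J) || (J \subset I).

Definition maximal_ideal I : Prop :=
  [/\ ideal I, I != setT &
      forall J, ideal J -> I \subset J -> J = I \/ J = setT].

Definition residue_classes I : {set {set R}} :=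
  [set [set x + y | y in I] | x in [set: R]].

Definition ideal_gen A : {set R} :=
  \bigcap_(I : {set R} | ideal I && (A \subset I)) I.

Definition ideal_pow I (k : nat) : {set R} :=
  ideal_gen [set \prod_(i < k) f i
            | f : {ffun 'I_k -> R} in ffun_on (mem I)].

Definition nilpotency_index I (s : nat) : Prop :=
  ideal_pow I s = [set 0] /\
  forall k, (k < s)%N -> ideal_pow I k <> [set 0].

(* The linear characters of [set: R], with R regarded as an additive group,
   are exactly the additive characters of R. *)
Definition generates_characters (psi : R -> algC) : Prop :=
  forall chi : 'CF([set: R]), chi \is a linear_char ->
    exists a : R, forall x : R, chi x = psi (a * x).

End ChainRings.

Section LinearCodes.
Variables (R : finComNzRingType) (n : nat).

Definition linear_code (C : {set 'rV[R]_n}) : Prop := submod_closed C.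

Definition dual_code (C : {set 'rV[R]_n}) : {set 'rV[R]_n} :=
  [set x : 'rV[R]_n | [forall c in C, \sum_(i < n) x 0 i * c 0 i == 0]].

End LinearCodes.

Section LeePartition.
Variables (R : finComNzRingType) (N : nat) (alpha : nat -> R).

(* N is the number of elements of R; only alpha 0, ..., alpha (N - 1) matter.
   In characteristic different from 2 such a labelling exists only if at most
   one nonzero element of R is its own opposite. *)
Definition lee_labelling : Prop :=
  [/\ perm_eq (mkseq alpha N) (enum R), alpha 0%N = 0 &
      2 \notin [pchar R] ->
      forall i, (0 < i < N)%N -> alpha (N - i)%N = - alpha i].

(* The blocks are numbered 0, ..., lee_last. *)
Definition lee_last : nat := if 2 \in [pchar R] then N.-1 else (N %/ 2)%N.

Definition lee_block (i : 'I_lee_last.+1) : {set R} :=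
  if 2 \in [pchar R] then [set alpha i] else [set alpha i; - alpha i].

End LeePartition.

Section Decompositions.
Variables (R : finComNzRingType) (n m : nat) (B : 'I_m.+1 -> {set R}).

Lemma card_ltn_succ (A : {set 'I_n}) : (#|A| < n.+1)%N.
Proof. by rewrite ltnS -[leqRHS]card_ord max_card. Qed.

(* Counts are at most n, so 'I_n.+1 loses nothing and keeps the type finite. *)
Definition decomp (x : 'rV[R]_n) : {ffun 'I_m.+1 -> 'I_n.+1} :=
  [ffun i => Ordinal (card_ltn_succ [set k | x 0 k \in B i])].

Definition decomps : {set {ffun 'I_m.+1 -> 'I_n.+1}} :=
  [set decomp x | x : 'rV[R]_n].

Definition decomp_enum (C : {set 'rV[R]_n}) (pi : {ffun 'I_m.+1 -> 'I_n.+1}) :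
  nat := #|[set c in C | decomp c == pi]|.

Definition krawtchouk (psi : R -> algC) (a : 'rV[R]_n)
    (rho : {ffun 'I_m.+1 -> 'I_n.+1}) : algC :=
  \sum_(x : 'rV[R]_n | decomp x == rho) \prod_(k < n) psi (a 0 k * x 0 k).

End Decompositions.

(* The row sums bound the entries by n. *)
Definition compositions (n m : nat) (pi rho : {ffun 'I_m.+1 -> 'I_n.+1}) :
    {set 'M['I_n.+1]_m.+1} :=
  [set t : 'M['I_n.+1]_m.+1 |
    [forall i, (\sum_(j < m.+1) t i j == pi i :> nat)%N] &&
    [forall j, (\sum_(i < m.+1) t i j == rho j :> nat)%N]].

Definition multinom (m a : nat) (k : 'I_m.+1 -> nat) : algC :=
  (a`!)%:R / \prod_(j < m.+1) ((k j)`!)%:R.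

Section Coefficients.
Variables (R : finComNzRingType) (p N n m l : nat).
Variables (xi : algC) (Tr : R -> 'Z_l) (rep : 'I_m.+1 -> R).

(* Well defined on residues mod l, and additive in y, when xi ^+ l = 1. *)
Definition xi_Tr (y : R) : algC := xi ^+ (Tr y : nat).

(* N is the number of elements of R and m is the last block index. The first
   two branches need blocks 0, ..., N %/ 2, so that ord_max has value N %/ 2.
   This fails only in characteristic 2 with N > 2, where every block is a
   singleton and each column contributes a single root of unity. *)
Definition kappa (t : 'M['I_n.+1]_m.+1) (i : 'I_m.+1) : algC :=
  let y j := rep i * rep j in
  if m == (N %/ 2)%N then
    if p == 2%N then
      (\prod_(j < m.+1 | (0 < j < m)%N)
          ((xi_Tr (y j))^-1 + xi_Tr (y j)) ^+ t i j)
      * xi_Tr (y ord_max) ^+ t i ord_max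
    else
      \prod_(j < m.+1 | (0 < j)%N) ((xi_Tr (y j))^-1 + xi_Tr (y j)) ^+ t i j
  else \prod_(j < m.+1) xi_Tr (y j) ^+ t i j.

Definition lee_krawtchouk (pi rho : {ffun 'I_m.+1 -> 'I_n.+1}) : algC :=
  \sum_(t in compositions pi rho)
    \prod_(i < m.+1) (multinom (pi i) (fun j => t i j) * kappa t i).

End Coefficients.

(* Main.v *)
Require Import Defs.
From HB Require Import structures.
From mathcomp Require Import all_boot all_order all_algebra.
From mathcomp Require Import all_fingroup all_solvable all_field all_character.
From mathcomp Require Import zify.

Set Implicit Arguments.
Unset Strict Implicit.
Unset Printing Implicit Defensive.

Import GRing.Theory Num.Theory.
Local Open Scope ring_scope.

(** Write psi for the additive character y |-> xi ^+ Tr y of R; every additive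
    character of R is of the form x |-> psi (a * x).  The proof has two halves: a
    duality argument, and the computation of the Krawtchouk coefficients.

    Duality.  As the characters of a finite abelian group separate its points,
    psi is not identically 1 on any nonzero ideal.  For a fixed word x, the
    products of x with the words of a linear code C form an ideal, so summing
    psi over them gives #|C| if x is orthogonal to C and 0 otherwise
    (sum_code_character).  Summing this over the words x of decomposition rho
    and exchanging the two sums gives MacWilliams' identity, for any partition
    for which the Krawtchouk coefficient of a depends only on the decomposition
    of a (decomp_enum_dual).

    Krawtchouk coefficients.  Let S i j be the sum of psi (a * y) for y in the
    block j, and suppose that it depends on a only through its block i.
    Grouping the words x by the blocks of their letters turns the coefficient
    of a into a sum over words w in block indices of the product of the
    S (g k) (w k), where g is the word of block indices of a.  This product
    depends only on the matrix t counting the positions k with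
    (g k, w k) = (i, j), and the number of words w with a given t is a product
    of multinomial coefficients, one for each row (card_joint_count).  So the
    coefficient is a sum over the compositions t (krawtchouk_compositions).

    For the Lee partition, replacing a by - a only permutes each block, so S is
    well defined.  A block {y, - y} contributes psi (a * y)^-1 + psi (a * y) or,
    when y = - y, the single term psi (a * y).  By the labelling, outside
    characteristic 2 the equality y = - y holds, apart from the block of 0,
    only in the block of index N / 2, for N = #|R| even; that is the case p = 2
    of the formula (kappaE). *)

(** * Counting words with a prescribed joint composition *)

Definition joint_count (I J : finType) n (g : 'I_n -> I) (f : 'I_n -> J)
    (i : I) (j : J) : nat :=
  (\sum_(k < n) ((g k == i) && (f k == j)))%N.

Definition ffun_cons (J : finType) n (p : J * {ffun 'I_n -> J}) :
    {ffun 'I_n.+1 -> J} :=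
  [ffun k => oapp p.2 p.1 (unlift ord0 k)].

Lemma ffun_cons_bij (J : finType) n : bijective (@ffun_cons J n).
Proof.
exists (fun f : {ffun _ -> J} => (f ord0, [ffun k => f (lift ord0 k)])).
  case=> j f.
  rewrite ffunE unlift_none; congr (_, _).
  by apply/ffunP=> k; rewrite !ffunE liftK.
move=> f; apply/ffunP=> k; rewrite ffunE.
by case: unliftP => [k'|] -> //=; rewrite ffunE.
Qed.

Lemma sum_ffun_cons (J : finType) n (F : {ffun 'I_n.+1 -> J} -> nat) :
  (\sum_f F f = \sum_j \sum_f F (ffun_cons (j, f)))%N.
Proof.
rewrite (reindex _ (onW_bij _ (@ffun_cons_bij J n))) pair_big.
by apply: eq_bigr => -[].
Qed.

Lemma joint_count_cons (I J : finType) n (g : 'I_n.+1 -> I) j0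
    (f : {ffun 'I_n -> J}) i j :
  joint_count g (ffun_cons (j0, f)) i j =
    (((g ord0 == i) && (j0 == j))
       + joint_count (fun k => g (lift ord0 k)) f i j)%N.
Proof.
rewrite /joint_count big_ord_recl ffunE unlift_none; congr (_ + _)%N.
by apply: eq_bigr => k _; rewrite ffunE liftK.
Qed.

(** Each row i is an independent choice of the letters at the positions where
    g takes the value i, hence the product of multinomial coefficients.  The
    induction on n splits off the first letter j, using that the multinomial
    coefficient of row g 0 is the sum over j of those with t (g 0) j lowered
    by one.  The factorials of the entries of t are kept on the left so that
    the identity stays in nat, without division. *)
Lemma card_joint_count (I J : finType) n (g : 'I_n -> I) (t : I -> J -> nat) :
  (forall i, \sum_j t i j = \sum_(k < n) (g k == i))%N ->
  ((\sum_(f : {ffun 'I_n -> J})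
      [forall i, forall j, joint_count g f i j == t i j])
     * \prod_i \prod_j (t i j)`! = \prod_i (\sum_j t i j)`!)%N.
Proof.
elim: n g t => [|n IHn] g t sum_t.
  have t0 i j : t i j = 0%N.
    apply/eqP; move: (sum_t i); rewrite big_ord0 => /eqP.
    by rewrite sum_nat_eq0 => /forallP/(_ j).
  have -> : (\sum_(f : {ffun 'I_0 -> J})
      [forall i, forall j, joint_count g f i j == t i j] = 1)%N.
    rewrite (eq_bigr (fun=> 1%N)) => [|f _].
      by rewrite sum1_card card_ffun card_ord.
    case: forallP => // -[] i; apply/forallP=> j.
    by rewrite t0 /joint_count big_ord0.
  rewrite mul1n; apply: eq_bigr => i _.
  rewrite (eq_bigr (fun=> 1%N)) => [|j _]; last by rewrite t0.
  by rewrite prod_nat_const exp1n sum_t big_ord0.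
set i0 := g ord0; set g' := fun k => g (lift ord0 k).
have row0 : (\sum_j t i0 j = (\sum_(k < n) (g' k == i0)).+1)%N.
  by rewrite sum_t big_ord_recl eqxx.
have rowS i : i != i0 -> (\sum_j t i j = \sum_(k < n) (g' k == i))%N.
  by move=> neq_i; rewrite sum_t big_ord_recl eq_sym (negPf neq_i).
rewrite sum_ffun_cons big_distrl /=.
(* Words beginning with j: deleting that letter lowers t i0 j by one. *)
rewrite (eq_bigr (fun j => t i0 j * \prod_i (\sum_(k < n) (g' k == i))`!))%N;
  last first.
  move=> j _; case: (posnP (t i0 j)) => [t0 | t_gt0].
    rewrite t0 mul0n big1 ?mul0n // => f _; apply/eqP; rewrite eqb0.
    apply/forallP=> /(_ i0)/forallP/(_ j).
    by rewrite joint_count_cons t0 /i0 !eqxx.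
  pose t' i j' := (t i j' - ((i0 == i) && (j == j')))%N.
  have tE i j' : t i j' = (((i0 == i) && (j == j')) + t' i j')%N.
    by rewrite /t'; case: andP => [[/eqP<- /eqP<-]|]; rewrite ?subn0 // subnKC.
  have sum_t' i : (\sum_j' t' i j' = \sum_(k < n) (g' k == i))%N.
    apply: (@addnI (i0 == i)); have := sum_t i; rewrite big_ord_recl => <-.
    rewrite (eq_bigr _ (fun j' _ => tE i j')) big_split /=; congr (_ + _)%N.
    rewrite (bigD1 j) //= eqxx andbT big1 ?addn0 // => j' /negPf.
    by rewrite eq_sym andbC => ->.
  have fact_t : (\prod_i \prod_j' (t i j')`!
                   = t i0 j * \prod_i \prod_j' (t' i j')`!)%N.
    have t'0 : t i0 j = (t' i0 j).+1 by rewrite tE !eqxx.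
    rewrite (bigD1 i0) // (bigD1 j) //=.
    rewrite [in RHS](bigD1 i0) // [in RHS](bigD1 j) //=.
    rewrite {1}t'0 factS -t'0 !mulnA; congr (_ * _ * _)%N.
      apply: eq_bigr => j' /negPf; rewrite tE eq_sym => ->.
      by rewrite andbF.
    apply: eq_bigr => i /negPf neq_i; apply: eq_bigr => j' _.
    by rewrite tE eq_sym neq_i.
  rewrite fact_t mulnCA; congr (_ * _)%N.
  rewrite -(eq_bigr _ (fun i _ => congr1 factorial (sum_t' i))).
  rewrite -(IHn _ _ sum_t'); congr (_ * _)%N; apply: eq_bigr => f _.
  congr nat_of_bool; apply: eq_forallb => i; apply: eq_forallb => j'.
  by rewrite joint_count_cons tE eqn_add2l.
rewrite -big_distrl /= row0 (bigD1 i0) //= [in RHS](bigD1 i0) //= row0 factS.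
by rewrite mulnA; congr (_ * _)%N; apply: eq_bigr => i /rowS ->.
Qed.

(** * Characters and duality *)

(** Linear characters of an abelian group separate its points: the common
    kernel of those of any group is its derived subgroup. *)
Lemma generates_characters_nontrivial (R : finComNzRingType) (psi : R -> algC)
    (x : R) :
  generates_characters psi -> x != 0 -> exists b, psi (b * x) != 1.
Proof.
move=> psi_gen x_neq0; apply/existsP; apply: contraR x_neq0 => /existsPn psi1.
have : x \in (1%g : {set R}).
  rewrite -(derG1P (FinRing.zmod_abelian [set: R])) -cap_cfker_lin_irr.
  apply/bigcapP=> i lin_chi; have [b chiE] := psi_gen _ lin_chi.
  rewrite cfkerEirr inE lin_char1 // chiE.
  by have /negbNE := psi1 b.
by move/set1P=> ->.
Qed.

Section Duality.
Variables (R : finComNzRingType) (n : nat) (psi : R -> algC).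
Hypothesis psiD : forall x y, psi (x + y) = psi x * psi y.
Hypothesis psi0 : psi 0 = 1.
Hypothesis psi_gen : generates_characters psi.

(** The sum of a character over a group vanishes unless the character is
    trivial there, and psi is trivial on the ideal formed by the products of x
    with the codewords only if this ideal is zero. *)
Lemma sum_code_character (C : {set 'rV[R]_n}) (x : 'rV[R]_n) :
  linear_code C ->
  \sum_(c in C) \prod_(k < n) psi (c 0 k * x 0 k)
    = (#|C| * (x \in dual_code C))%:R.
Proof.
move=> linC; have [C0 CZD] := linC.
have prodE (c : 'rV[R]_n) :
    \prod_(k < n) psi (c 0 k * x 0 k) = psi (\sum_k x 0 k * c 0 k).
  rewrite (big_morph psi psiD psi0).
  by apply: eq_bigr => k _; rewrite mulrC.
rewrite (eq_bigr _ (fun c _ => prodE c)) inE.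
case: forallP => [dual_x | /forallP].
  rewrite muln1 -sum1_card natr_sum; apply: eq_bigr => c Cc.
  by have /implyP/(_ Cc)/eqP -> := dual_x c.
rewrite muln0 negb_forall => /existsP[c]; rewrite negb_imply => /andP[Cc].
move=> /(generates_characters_nontrivial psi_gen)[b psi_neq1].
(* Translating by b *: c multiplies the sum by a scalar different from 1. *)
set S := (X in X = _).
have SE : S = psi (b * \sum_i x 0 i * c 0 i) * S.
  rewrite {1}/S (reindex_inj (addrI (b *: c))) /= /S mulr_sumr.
  apply: eq_big => d.
    apply/idP/idP => Cd; last exact: CZD.
    by have := CZD (- b) c (b *: c + d) Cc Cd; rewrite scaleNr addKr.
  move=> _; rewrite -psiD; congr psi.
  rewrite mulr_sumr -big_split; apply: eq_bigr => i _ /=.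
  by rewrite !mxE mulrDr mulrCA.
apply/eqP; move/eqP: SE; rewrite -subr_eq0 -{1}[S]mul1r -mulrBl mulf_eq0.
by rewrite subr_eq0 eq_sym (negPf psi_neq1).
Qed.

(** MacWilliams' identity, for an arbitrary family B of sets of letters: the sum
    of the Krawtchouk coefficients of the codewords, computed by summing over
    the codewords first, counts each dual codeword #|C| times. *)
Lemma decomp_enum_dual m (B : 'I_m.+1 -> {set R}) (C : {set 'rV[R]_n})
    (rho : {ffun 'I_m.+1 -> 'I_n.+1}) (K : {ffun 'I_m.+1 -> 'I_n.+1} -> algC) :
  linear_code C ->
  (forall c, c \in C -> krawtchouk B psi c rho = K (decomp B c)) ->
  (decomp_enum B (dual_code C) rho)%:R
    = (#|C|%:R)^-1
      * \sum_(pi in decomps n B) K pi * (decomp_enum B C pi)%:R.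
Proof.
move=> linC KE; have [C0 _] := linC.
have C_neq0 : #|C|%:R != 0 :> algC.
  by rewrite pnatr_eq0 -lt0n; apply/card_gt0P; exists 0.
apply: (mulfI C_neq0); rewrite mulVKf //.
transitivity (\sum_(c in C) krawtchouk B psi c rho).
  rewrite /krawtchouk exchange_big /=.
  rewrite (eq_bigr _ (fun x _ => sum_code_character x linC)).
  rewrite -natr_sum -natrM -big_distrr /=; congr (_ * _)%:R.
  rewrite /decomp_enum -sum1_card big_mkcond [RHS]big_mkcond /=.
  by apply: eq_bigr => x _; rewrite inE andbC; case: (_ == _); case: (_ \in _).
rewrite (partition_big (decomp B) (mem (decomps n B))) => [|c _];
  last exact: imset_f.
apply: eq_bigr => pi _; rewrite /decomp_enum -sum1_card natr_sum mulr_sumr.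
apply: eq_big => [c|c /andP[Cc /eqP <-]]; first by rewrite inE.
by rewrite KE ?mulr1.
Qed.
End Duality.

(** * Krawtchouk coefficients as sums over compositions *)

Lemma joint_count_leq (I J : finType) n (g : 'I_n -> I) (f : 'I_n -> J) i j :
  (joint_count g f i j < n.+1)%N.
Proof.
rewrite ltnS -[leqRHS]card_ord -sum1_card; apply: leq_sum => k _.
exact: leq_b1.
Qed.

Lemma sum_joint_count_row (I J : finType) n (g : 'I_n -> I) (f : 'I_n -> J) i :
  (\sum_j joint_count g f i j = \sum_(k < n) (g k == i))%N.
Proof.
rewrite exchange_big; apply: eq_bigr => k _ /=.
rewrite (bigD1 (f k)) //= eqxx andbT big1 ?addn0 // => j.
by rewrite eq_sym => /negPf ->; rewrite andbF.
Qed.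

Lemma sum_joint_count_col (I J : finType) n (g : 'I_n -> I) (f : 'I_n -> J) j :
  (\sum_i joint_count g f i j = \sum_(k < n) (f k == j))%N.
Proof.
rewrite -(sum_joint_count_row f g); apply: eq_bigr => i _.
by apply: eq_bigr => k _; rewrite andbC.
Qed.

Lemma prod_joint_count (I J : finType) n (g : 'I_n -> I) (f : 'I_n -> J)
    (S : I -> J -> algC) :
  \prod_(k < n) S (g k) (f k) = \prod_i \prod_j S i j ^+ joint_count g f i j.
Proof.
under [RHS]eq_bigr do under eq_bigr do rewrite -prodrXr.
under [RHS]eq_bigr do rewrite exchange_big /=.
rewrite exchange_big; apply: eq_bigr => k _ /=.
rewrite (bigD1 (g k)) //= (bigD1 (f k)) //= !eqxx expr1 !big1 ?mulr1 //.
  by move=> i; rewrite eq_sym => /negPf->; rewrite big1.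
by move=> j; rewrite eq_sym => /negPf->; rewrite andbF.
Qed.

Section Krawtchouk.
Variables (R : finComNzRingType) (n m : nat) (B : 'I_m.+1 -> {set R}).
Variables (psi : R -> algC) (blk : R -> 'I_m.+1).
Variable S : 'I_m.+1 -> 'I_m.+1 -> algC.
Hypothesis mem_block : forall y j, (y \in B j) = (blk y == j).
Hypothesis sum_block : forall a j, \sum_(y in B j) psi (a * y) = S (blk a) j.

Lemma decompE (x : 'rV[R]_n) i :
  decomp B x i = (\sum_(k < n) (blk (x ord0 k) == i))%N :> nat.
Proof.
rewrite ffunE /= -sum1_card big_mkcond; apply: eq_bigr => k _.
by rewrite inE mem_block; case: eqP.
Qed.

Lemma decomp_eqE (x : 'rV[R]_n) (rho : {ffun 'I_m.+1 -> 'I_n.+1}) :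
  (decomp B x == rho)
    = [forall j, (\sum_(k < n) (blk (x ord0 k) == j) == rho j :> nat)%N].
Proof.
apply/eqP/forallP => [<- j | H]; first by rewrite decompE.
by apply/ffunP=> j; apply: val_inj => /=; rewrite decompE; apply/eqP.
Qed.

(** Fixing the blocks of all the letters of x leaves independent choices of the
    letters, so that the sum of products factors. *)
Lemma krawtchouk_words (a : 'rV[R]_n) (rho : {ffun 'I_m.+1 -> 'I_n.+1}) :
  krawtchouk B psi a rho =
    \sum_(w : {ffun 'I_n -> 'I_m.+1}
           | [forall j, (\sum_(k < n) (w k == j) == rho j :> nat)%N])
      \prod_(k < n) S (blk (a 0 k)) (w k).
Proof.
rewrite /krawtchouk.
rewrite (partition_big (fun x : 'rV[R]_n => [ffun k => blk (x 0 k)])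
  (fun w : {ffun 'I_n -> 'I_m.+1} =>
    [forall j, (\sum_(k < n) (w k == j) == rho j :> nat)%N])) /=; last first.
  move=> x; rewrite decomp_eqE => /forallP H; apply/forallP => j.
  by rewrite -(eqP (H j)); apply/eqP/eq_bigr => k _; rewrite ffunE.
apply: eq_bigr => w /forallP w_rho.
under [RHS]eq_bigr do rewrite -sum_block.
rewrite bigA_distr_big_dep /=.
rewrite (reindex (fun f : {ffun 'I_n -> R} => \row_k f k)) /=; last first.
  exists (fun x : 'rV[R]_n => [ffun k => x 0 k]) => [f|x] _.
    by apply/ffunP=> k; rewrite ffunE mxE.
  by apply/rowP=> k; rewrite mxE ffunE.
apply: eq_big => [f | f _]; last by apply: eq_bigr => k _; rewrite mxE.
apply/andP/familyP => [[_ /eqP <-] k | fam].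
  by rewrite mem_block !ffunE mxE.
have wE k : blk (f k) = w k.
  by apply/eqP; have := fam k; rewrite mem_block.
split; last by apply/eqP/ffunP=> k; rewrite ffunE mxE.
rewrite decomp_eqE; apply/forallP=> j; rewrite -(eqP (w_rho j)).
by apply/eqP/eq_bigr => k _; rewrite mxE wE.
Qed.

(** All words with the same joint counts contribute the same product, and
    the number of these words is a product of multinomial coefficients. *)
Lemma krawtchouk_compositions (a : 'rV[R]_n) (rho : {ffun 'I_m.+1 -> 'I_n.+1}) :
  krawtchouk B psi a rho =
    \sum_(t in compositions (decomp B a) rho)
      \prod_i (multinom (decomp B a i) (fun j => t i j)
               * \prod_j S i j ^+ t i j).
Proof.
rewrite krawtchouk_words; set g := fun k => blk (a 0 k).
pose tw (w : {ffun 'I_n -> 'I_m.+1}) : 'M['I_n.+1]_m.+1 :=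
  \matrix_(i, j) Ordinal (joint_count_leq g w i j).
rewrite (partition_big tw (mem (compositions (decomp B a) rho))) /=; last first.
  move=> w /forallP w_rho; rewrite inE; apply/andP; split; apply/forallP=> i.
    by under eq_bigr do rewrite mxE /=; rewrite sum_joint_count_row decompE.
  by under eq_bigr do rewrite mxE /=; rewrite sum_joint_count_col.
apply: eq_bigr => t; rewrite inE => /andP[/forallP rowt /forallP colt].
have twE w : (tw w == t) = [forall i, forall j, joint_count g w i j == t i j].
  apply/eqP/forallP => [<- i | H]; first by apply/forallP=> j; rewrite mxE.
  by apply/matrixP=> i j; apply: val_inj => /=; rewrite mxE;
    apply/eqP/(forallP (H i)).
transitivity (\sum_(w | tw w == t) \prod_i \prod_j S i j ^+ t i j).
  apply: eq_big => [w | w /andP[_ /eqP <-]].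
    rewrite andbC; case: eqP => //= wt; apply/forallP=> j.
    rewrite -(eqP (colt j)) -(sum_joint_count_col g); apply/eqP/eq_bigr => i _.
    by rewrite -wt mxE.
  rewrite (@prod_joint_count _ _ _ g).
  apply: eq_bigr => i _; apply: eq_bigr => j _.
  by rewrite mxE.
rewrite sumr_const big_split -mulr_natl /=; congr (_ * _).
rewrite /multinom prodf_div.
have rowt' i : (\sum_j t i j = \sum_(k < n) (g k == i))%N.
  by rewrite (eqP (rowt i)) decompE.
have := card_joint_count rowt'.
have <- : #|[pred w | tw w == t]| = (\sum_(f : {ffun 'I_n -> 'I_m.+1})
  [forall i, forall j, joint_count g f i j == t i j])%N.
  rewrite -sum1_card big_mkcond; apply: eq_bigr => w _.
  by rewrite inE twE; case: ifP.
move=> cardE; apply: (canRL (mulfK _)).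
  apply/prodf_neq0 => i _; apply/prodf_neq0 => j _.
  by rewrite pnatr_eq0 -lt0n fact_gt0.
under eq_bigr do rewrite -natr_prod.
rewrite -natr_prod -natrM cardE natr_prod.
by apply: eq_bigr => i _; rewrite (eqP (rowt i)).
Qed.
End Krawtchouk.

(** * Sums of a character over the blocks of the Lee partition *)

Section LeeBlocks.
Variables (R : finComNzRingType) (N : nat) (alpha : nat -> R).
Hypothesis alpha_lee : lee_labelling N alpha.
Let B := @lee_block R N alpha.

Lemma lee_card_gt1 : (1 < N)%N.
Proof.
have [/perm_size + _ _] := alpha_lee.
by rewrite size_mkseq -cardE => ->; apply: card_finNzRing_gt1.
Qed.

Lemma lee_surj y : exists2 i, (i < N)%N & y = alpha i.
Proof.
have [/perm_mem alphaE _ _] := alpha_lee.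
have : y \in mkseq alpha N by rewrite alphaE mem_enum.
by case/mapP=> i; rewrite mem_iota => /= iN ->; exists i.
Qed.

Lemma lee_inj i j : (i < N)%N -> (j < N)%N -> alpha i = alpha j -> i = j.
Proof.
have [/perm_uniq alpha_uniq _ _] := alpha_lee.
move=> iN jN /eqP; rewrite -(nth_mkseq 0 alpha iN) -(nth_mkseq 0 alpha jN).
by rewrite nth_uniq ?size_mkseq ?alpha_uniq ?enum_uniq // => /eqP.
Qed.

Lemma lee_last_ltn : (lee_last R N < N)%N.
Proof.
have N_gt1 := lee_card_gt1; rewrite /lee_last; case: ifP => _.
  by rewrite prednK // ltnW.
by rewrite ltn_Pdiv // ltnW.
Qed.

Lemma lee_ord_ltn (j : 'I_(lee_last R N).+1) : (j < N)%N.
Proof. by apply: leq_ltn_trans lee_last_ltn; rewrite -ltnS. Qed.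

Lemma lee_ord_half (j : 'I_(lee_last R N).+1) :
  2 \notin [pchar R] -> (j + j <= N)%N.
Proof.
move=> char2; have := ltn_ord j; rewrite {2}/lee_last (negPf char2) ltnS => jN.
rewrite addnn -muln2; apply: leq_trans (leq_trunc_div N 2).
by rewrite leq_mul2r.
Qed.

Lemma mem_lee_block y (j : 'I_(lee_last R N).+1) :
  (y \in B j) = (y == alpha j) || (2 \notin [pchar R]) && (y == - alpha j).
Proof.
by rewrite /B /lee_block; case: ifP => _ /=; rewrite !inE ?orbF.
Qed.

(** A label beyond the last block belongs to the block of the opposite
    element, whose label is N - i. *)
Lemma lee_block_cover y : exists j, y \in B j.
Proof.
have [_ _ alphaN] := alpha_lee.
have [i iN ->] := lee_surj y.
have [i_le | i_gt] := leqP i (lee_last R N).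
  exists (Ordinal (i_le : (i < (lee_last R N).+1)%N)).
  by rewrite mem_lee_block eqxx.
have char2 : 2 \notin [pchar R].
  apply/negP=> char2; move: i_gt; rewrite /lee_last char2 ltnNge.
  by rewrite -ltnS prednK ?iN // (leq_ltn_trans _ iN).
have i_gt0 : (0 < i)%N by apply: leq_ltn_trans i_gt.
have Ni_le : (N - i < (lee_last R N).+1)%N.
  by move: i_gt; rewrite /lee_last (negPf char2); lia.
exists (Ordinal Ni_le); rewrite mem_lee_block char2 /=; apply/orP; right.
by rewrite alphaN ?opprK // i_gt0.
Qed.

(** Outside characteristic 2, two distinct labels in the same block add up to
    N, so they cannot both be at most N / 2. *)
Lemma lee_block_inj y i j : y \in B i -> y \in B j -> i = j.
Proof.
have [_ alpha0 alphaN] := alpha_lee.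
have [iN jN] := (lee_ord_ltn i, lee_ord_ltn j).
rewrite !mem_lee_block => yi yj; apply: val_inj => /=.
have [alphaE | /andP[char2 /eqP alphaE]] : alpha i = alpha j
    \/ (2 \notin [pchar R]) && (alpha i == - alpha j).
- case/orP: yi => [/eqP <- | /andP[char2 /eqP yi]].
    by case/orP: yj => [/eqP ? |]; [left | right].
  rewrite char2; case/orP: yj => [/eqP <- | /andP[_ /eqP yj]].
    by right; rewrite yi opprK eqxx.
  by left; apply: oppr_inj; rewrite -yi.
- exact: lee_inj.
have [j0 | j_gt0] := posnP j.
  by apply: lee_inj => //; rewrite alphaE j0 alpha0 oppr0.
move: alphaE; rewrite -alphaN ?j_gt0 // => /lee_inj iE.
have {}iE : i = (N - j)%N :> nat.
  by apply: iE; rewrite // ltn_subrL j_gt0 (ltn_trans j_gt0).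
have [i2 j2] := (lee_ord_half i char2, lee_ord_half j char2).
by apply/eqP; lia.
Qed.

(** As the blocks cover R, the default ord0 never arises. *)
Definition lee_index (y : R) : 'I_(lee_last R N).+1 :=
  odflt ord0 [pick j | y \in B j].

Lemma lee_indexP y j : (y \in B j) = (lee_index y == j).
Proof.
have yB : y \in B (lee_index y).
  rewrite /lee_index; case: pickP => [//|noB] /=.
  by have [i yi] := lee_block_cover y; move: (noB i); rewrite yi.
by apply/idP/eqP => [/(lee_block_inj yB) | <-].
Qed.

Variable rep : 'I_(lee_last R N).+1 -> R.
Hypothesis rep_block : forall k, rep k \in B k.

Lemma lee_block_rep j :
  B j = if 2 \in [pchar R] then [set rep j] else [set rep j; - rep j].
Proof.
have := rep_block j; rewrite /B /lee_block; case: ifP => _.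
  by move/set1P->.
by case/set2P=> -> //; rewrite opprK setUC.
Qed.

Lemma rep0 : rep ord0 = 0.
Proof.
have [_ alpha0 _] := alpha_lee.
have := rep_block ord0; rewrite mem_lee_block /= alpha0 oppr0.
by case/orP => [/eqP | /andP[_ /eqP]].
Qed.

(** By the labelling, - alpha j = alpha (N - j), and alpha is injective. *)
Lemma rep_oppr (j : 'I_(lee_last R N).+1) : 2 \notin [pchar R] -> (0 < j)%N ->
  (rep j == - rep j) = (j + j == N)%N.
Proof.
have [_ _ alphaN] := alpha_lee => char2 j_gt0; have jN := lee_ord_ltn j.
have -> : (rep j == - rep j) = (alpha j == - alpha j).
  have := rep_block j; rewrite mem_lee_block char2 /=.
  by case/orP => /eqP ->; rewrite // opprK eq_sym.
rewrite -alphaN ?j_gt0 //; apply/eqP/eqP => [alphaE | jj].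
  by have := @lee_inj j (N - j)%N jN _ alphaE; lia.
by congr alpha; lia.
Qed.

Variable psi : R -> algC.
Hypothesis psiD : forall x y, psi (x + y) = psi x * psi y.
Hypothesis psi0 : psi 0 = 1.

(** The sum depends on a only through its block, because a block is stable
    under opposites. *)
Lemma sum_lee_block a (j : 'I_(lee_last R N).+1) :
  \sum_(y in B j) psi (a * y) = \sum_(y in B j) psi (rep (lee_index a) * y).
Proof.
have : a \in B (lee_index a) by rewrite lee_indexP.
rewrite {1}lee_block_rep; case: ifP => char2; first by move/set1P <-.
case/set2P=> {1}->; first by [].
rewrite (reindex_inj oppr_inj) /=; apply: eq_big => y.
  by rewrite lee_block_rep char2 !inE !eqr_oppLR opprK orbC.
by rewrite mulrNN.
Qed.

Lemma character_opp y : psi (- y) = (psi y)^-1.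
Proof.
have psi_mulV : psi y * psi (- y) = 1 by rewrite -psiD subrr.
have psi_neq0 : psi y != 0.
  by apply: contra_eq_neq psi_mulV => ->; rewrite mul0r eq_sym oner_neq0.
by rewrite -[RHS]mulr1 -psi_mulV mulKf.
Qed.

Lemma sum_lee_block0 a : \sum_(y in B ord0) psi (a * y) = 1.
Proof.
by rewrite lee_block_rep rep0 oppr0 setUid if_same big_set1 mulr0.
Qed.

Lemma sum_lee_block_pchar2 a (j : 'I_(lee_last R N).+1) :
  2 \in [pchar R] -> \sum_(y in B j) psi (a * y) = psi (a * rep j).
Proof. by move=> char2; rewrite lee_block_rep char2 big_set1. Qed.

Lemma sum_lee_block_half a (j : 'I_(lee_last R N).+1) :
  (j + j == N)%N -> \sum_(y in B j) psi (a * y) = psi (a * rep j).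
Proof.
move=> jj; case: (boolP (2 \in [pchar R])) => char2.
  exact: sum_lee_block_pchar2.
have j_gt0 : (0 < j)%N.
  rewrite lt0n; apply: contraTneq (lee_card_gt1) => j0.
  by rewrite -(eqP jj) j0.
have /eqP repN : rep j == - rep j by rewrite rep_oppr.
by rewrite lee_block_rep (negPf char2) -repN setUid big_set1.
Qed.

Lemma sum_lee_block_pair a (j : 'I_(lee_last R N).+1) :
  2 \notin [pchar R] -> (0 < j)%N -> (j + j != N)%N ->
  \sum_(y in B j) psi (a * y) = (psi (a * rep j))^-1 + psi (a * rep j).
Proof.
move=> char2 j_gt0 jj; rewrite lee_block_rep (negPf char2).
by rewrite big_setU1 ?inE ?rep_oppr //= big_set1 mulrN character_opp addrC.
Qed.

End LeeBlocks.

(** Exponents add modulo l only, which is harmless since xi ^+ l = 1; the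
    condition 1 < l makes l the actual modulus of 'Z_l. *)
Lemma xi_TrD (R : finComNzRingType) l (xi : algC)
    (Tr : {additive R -> 'Z_l}) x y :
  (1 < l)%N -> xi ^+ l = 1 ->
  xi_Tr xi Tr (x + y) = xi_Tr xi Tr x * xi_Tr xi Tr y.
Proof.
move=> l_gt1 xi1; rewrite /xi_Tr raddfD /= -exprD.
by apply: expr_mod; rewrite Zp_cast.
Qed.

(** The factor kappa is the product of the block sums.  The block of 0 has sum 1
    and may be dropped; for p = 2 the last block has index N / 2, hence is a
    singleton.  In characteristic 2 the first two branches only arise for N = 2,
    where the blocks {0} and {1} fit the case p = 2. *)
Lemma kappaE (R : finComNzRingType) p k N (alpha : nat -> R) l (xi : algC)
    (Tr : {additive R -> 'Z_l}) (rep : 'I_(lee_last R N).+1 -> R) n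
    (t : 'M['I_n.+1]_((lee_last R N).+1)) i :
  prime p -> N = (p ^ k)%N -> (1 < l)%N -> xi ^+ l = 1 ->
  lee_labelling N alpha ->
  (forall j, rep j \in lee_block alpha j) ->
  kappa p N xi Tr rep t i =
    \prod_j (\sum_(y in lee_block alpha j) xi_Tr xi Tr (rep i * y)) ^+ t i j.
Proof.
move=> p_prime N_def l_gt1 xi1 alpha_lee rep_block.
have psiD x y := @xi_TrD R l xi Tr x y l_gt1 xi1.
have psi0 : xi_Tr xi Tr 0 = 1 by rewrite /xi_Tr raddf0.
have N_gt1 := lee_card_gt1 alpha_lee.
have k_gt0 : (0 < k)%N.
  by rewrite lt0n; apply: contraTneq N_gt1 => k0; rewrite N_def k0.
pose S (j : 'I_(lee_last R N).+1) :=
  \sum_(y in lee_block alpha j) xi_Tr xi Tr (rep i * y).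
have S0 : S ord0 = 1 by apply: (sum_lee_block0 alpha_lee rep_block psi0).
rewrite /kappa; case: eqP => [m_half | m_nhalf]; last first.
  have char2 : 2 \in [pchar R].
    by apply/negPn/negP=> char2; case: m_nhalf; rewrite /lee_last (negPf char2).
  by apply: eq_bigr => j _; rewrite (sum_lee_block_pchar2 rep_block).
have Npair (j : 'I_(lee_last R N).+1) : (0 < j)%N -> (j + j != N)%N ->
    S j = (xi_Tr xi Tr (rep i * rep j))^-1 + xi_Tr xi Tr (rep i * rep j).
  move=> j_gt0 jj; apply: (sum_lee_block_pair alpha_lee rep_block) => //.
  (* In characteristic 2, having N %/ 2 + 1 blocks forces N = 2, so j = 1. *)
  apply/negP=> char2; have := lee_ord_ltn alpha_lee j.
  have m_last : lee_last R N = N.-1 by rewrite /lee_last char2.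
  lia.
case: eqP => [p2 | p_neq2].
  have N_even : ~~ odd N by rewrite N_def p2 oddX /= orbF -lt0n.
  have m2 : (lee_last R N + lee_last R N)%N = N.
    by rewrite m_half divn2 addnn even_halfK.
  rewrite [RHS](bigD1 ord_max) //= mulrC; congr (_ ^+ _ * _).
    by rewrite (sum_lee_block_half alpha_lee rep_block) //= m2.
  rewrite big_mkcond [RHS]big_mkcond; apply: eq_bigr => j _; rewrite -/(S j).
  have [j0 | j_gt0] := posnP j.
    have -> : j = ord0 by apply: val_inj.
    by rewrite S0 expr1n if_same.
  have -> : (j != ord_max) = (j < lee_last R N)%N.
    by rewrite -val_eqE /= ltn_neqAle -ltnS ltn_ord andbT.
  by rewrite /=; case: ifP => // jm; rewrite -Npair //; apply/eqP; lia.
have N_odd : odd N.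
  by rewrite N_def oddX; case: (even_prime p_prime) => // ->; rewrite orbT.
rewrite big_mkcond; apply: eq_bigr => j _; rewrite -/(S j).
have [j0 | j_gt0] := posnP j.
  have -> : j = ord0 by apply: val_inj.
  by rewrite S0 expr1n.
rewrite -Npair //; apply: contraTneq N_odd => <-.
by rewrite addnn odd_double.
Qed.

Theorem corollary24
  (R : finComNzRingType) (p r q s : nat) (mm : {set R})
  (p_prime : prime p) (q_def : q = (p ^ r)%N)
  (R_chain : chain_ring R) (mm_max : maximal_ideal mm)
  (residue_card : #|residue_classes mm| = q)
  (s_nilp : nilpotency_index mm s)
  (e : nat) (e_bounds : (0 < e <= s)%N)
  (xi : algC) (xi_root : xi ^+ (p ^ e)%N = 1)
  (Tr : {additive R -> 'Z_(p ^ e)})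
  (Tr_gen : generates_characters (xi_Tr xi Tr))
  (alpha : nat -> R) (alpha_lee : lee_labelling (q ^ s)%N alpha)
  (rep : 'I_(lee_last R (q ^ s)).+1 -> R)
  (rep_block : forall k, rep k \in lee_block alpha k)
  (n : nat) (n_gt0 : (0 < n)%N)
  (C : {set 'rV[R]_n}) (C_linear : linear_code C)
  (rho : {ffun 'I_(lee_last R (q ^ s)).+1 -> 'I_n.+1})
  (rho_dec : rho \in decomps n (lee_block alpha)) :
  let B := @lee_block R (q ^ s)%N alpha in
  let K pi := lee_krawtchouk p (q ^ s)%N xi Tr rep pi rho in
  (forall pi, pi \in decomps n B ->
     forall a : 'rV[R]_n, decomp B a = pi ->
       krawtchouk B (xi_Tr xi Tr) a rho = K pi) /\
  (decomp_enum B (dual_code C) rho)%:R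
    = (#|C|%:R)^-1
      * \sum_(pi in decomps n B) K pi * (decomp_enum B C pi)%:R.
Proof.
move=> B K; set psi := xi_Tr xi Tr.
have [e_gt0 _] := andP e_bounds.
have l_gt1 : (1 < p ^ e)%N by rewrite -(expn0 p) ltn_exp2l ?prime_gt1.
have psiD x y : psi (x + y) = psi x * psi y by apply: xi_TrD.
have psi0 : psi 0 = 1 by rewrite /psi /xi_Tr raddf0.
have N_def : (q ^ s)%N = (p ^ (r * s))%N by rewrite q_def -expnM.
have krawtchoukE (a : 'rV[R]_n) : krawtchouk B psi a rho = K (decomp B a).
  rewrite (@krawtchouk_compositions _ _ _ _ _ _
             (fun i j => \sum_(y in B j) psi (rep i * y))
             (lee_indexP alpha_lee)
             (sum_lee_block alpha_lee rep_block psi)).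
  apply: eq_bigr => t _; apply: eq_bigr => i _; congr (_ * _).
  by rewrite (kappaE Tr t i p_prime N_def l_gt1 xi_root alpha_lee rep_block).
split=> [pi _ a <- //|].
exact: (decomp_enum_dual psiD psi0 Tr_gen C_linear).
Qed.
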